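(* Let $T\in\,]0,+\infty]$, let $P\in\mathbb R^{n\times n}$ be symmetric positive definite, let $f$ and $g_1,\dots,g_k$ be smooth vector fields on $\mathbb R^n$, $G=(g_1,\dots,g_k)$, $x_0\in\mathbb R^n$ (and, if $T<+\infty$ and an endpoint condition is imposed, $x_T\in\mathbb R^n$). Let $\rho:[0,T]\times\mathbb R^k\to[0,+\infty[$ be a nonnegative Borel function, let $\mathcal U_\rho$, $J_0^T$, $J_\varepsilon^T$ be as defined in the context, and let $\mathcal U\supset\mathcal U_\rho$ be a class of controls. Then the equality $$\lim_{\varepsilon\to0^+}\ \inf_{u\in\mathcal U_\rho}J^T_\varepsilon(u)=\inf_{u\in\mathcal U}J_0^T(u)$$ holds if and only if $J_0^T$ does not possess a $\mathcal U-\mathcal U_\rho$ Lavrentiev gap.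
   Context: Control system: $\dot x=f(x)+G(x)u$, $x(0)=x_0$, with trajectory $x_u$ corresponding to the control $u$. If $T=+\infty$, $[0,T]$ means $[0,+\infty[$. $\mathcal U_\rho=\{u:[0,T]\to\mathbb R^k \text{ measurable}: \int_0^T\rho(t,u(t))\,dt<+\infty\}$. The class $\mathcal U$ is any class of controls $u:[0,T]\to\mathbb R^k$ containing $\mathcal U_\rho$ (not necessarily defined by an integrability condition of this type). Cost functionals: $J_0^T(u)=\int_0^T x_u(t)'Px_u(t)\,dt$ and, for $\varepsilon>0$, $J_\varepsilon^T(u)=\int_0^T \big(x_u(t)'Px_u(t)+\varepsilon\rho(t,u(t))\big)\,dt$; by convention these equal $+\infty$ for any control for which the control system has no solution on $[0,T[$. When $T<+\infty$, an endpoint condition $x(T)=x_T$ may be added; in that case all infima are taken over controls whose trajectory satisfies $x_u(T)=x_T$. $J_0^T$ possesses a $\mathcal U-\mathcal U_\rho$ Lavrentiev gap if $\inf_{u\in\mathcal U}J_0^T(u)<\inf_{u\in\mathcal U_\rho}J_0^T(u)$. *)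

(* Defs.v *)
From HB Require Import structures.
From mathcomp Require Import all_boot all_order all_algebra.
From mathcomp Require Import all_classical all_reals all_analysis.
Set Implicit Arguments.
Unset Strict Implicit.
Unset Printing Implicit Defensive.
Import Order.TTheory GRing.Theory Num.Theory.
Import numFieldNormedType.Exports.
Local Open Scope classical_set_scope.
Local Open Scope ring_scope.

(* The real line with its sigma-algebra of Lebesgue measurable sets.  The
   canonical sigma-algebra of R in the library is the Borel one, whereas controls
   are only Lebesgue measurable. *)
Notation lebR R := (caratheodory_type ((@wlength R idfun)^*)%mu).
Notation leb := completed_lebesgue_measure.

Section smooth.
Context {R : realType} {n m : nat}.
Implicit Types F : 'cV[R]_n -> 'cV[R]_m.

Fixpoint class_C (r : nat) F : Prop :=
  match r with
  | 0 => continuous F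
  | s.+1 => (forall x, differentiable F x) /\ forall v, class_C s ('D_v F)
  end.

Definition smooth F := forall r, class_C r F.

End smooth.

Section quadratic_form.
Context {R : realType} {n : nat}.

Definition quad (P : 'M[R]_n) (x : 'cV[R]_n) : R := (x^T *m P *m x) ord0 ord0.

Definition sym_posdef (P : 'M[R]_n) :=
  P^T = P /\ forall x, x != 0 -> 0 < quad P x.

End quadratic_form.

Section horizon.
Context {R : realType}.

(* [0, T], which is [0, +oo[ for T = +oo *)
Definition horizon (T : \bar R) : set R := [set t | 0 <= t /\ (t%:E <= T)%E].

Definition horizon_open (T : \bar R) : set R :=
  [set t | 0 <= t /\ (t%:E < T)%E].

End horizon.

(* Functions on [0, T] are represented by total functions on R, whose values
   outside of [0, T] are irrelevant. *)
Section controls.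
Context {R : realType} {k : nat}.

Definition lebesgue_measurable_on (A : set R) (u : R -> 'cV[R]_k) :=
  forall i, measurable_fun (A : set (lebR R)) (fun t : lebR R => u t i ord0).

(* Borel measurability on A x R^k, for the sigma-algebra generated by the open
   subsets of R x R^k. *)
Definition borel_on (A : set R) (rho : R -> 'cV[R]_k -> R) :=
  measurable_fun
    (A `*` setT : set (g_sigma_algebraType (@open (R * 'cV[R]_k)%type)))
    (fun p : g_sigma_algebraType (@open (R * 'cV[R]_k)%type) => rho p.1 p.2).

Definition Urho (T : \bar R) (rho : R -> 'cV[R]_k -> R) :
    set (R -> 'cV[R]_k) :=
  [set u | lebesgue_measurable_on (horizon T) u /\
    (\int[@leb R]_(t in horizon T) (rho t (u t))%:E < +oo)%E].

End controls.

Section control_system.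
Context {R : realType} {n k : nat}.
Variables (T : \bar R) (f : 'cV[R]_n -> 'cV[R]_n)
  (g : 'I_k -> 'cV[R]_n -> 'cV[R]_n) (x0 : 'cV[R]_n).
Implicit Types (u : R -> 'cV[R]_k) (x : R -> 'cV[R]_n).

Definition Gmx (y : 'cV[R]_n) : 'M[R]_(n, k) := \matrix_(i, j) g j y i ord0.

Definition velocity u x (t : R) : 'cV[R]_n := f (x t) + Gmx (x t) *m u t.

(* x is a Caratheodory solution on [0, T[ (the right end point is excluded) of
   x' = f(x) + G(x) u, x(0) = x0, in integral form. *)
Definition is_solution u x :=
  {within horizon_open T, continuous x} /\
  forall t, horizon_open T t -> forall i,
    (@leb R).-integrable `[0, t] (fun s => (velocity u x s i ord0)%:E) /\
    x t i ord0 =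
      x0 i ord0 + \int[@leb R]_(s in `[0, t]) velocity u x s i ord0.

Definition solvable u := exists x, is_solution u x.

(* Smoothness of f and G gives a unique trajectory on [0, T[ for locally
   integrable u, but not for every measurable u (x' = x u, u(t) = 1 / t,
   x(0) = 0).  Hence u |-> x_u is any map picking a solution whenever there is
   one. *)
Definition trajectory_map (x_ : (R -> 'cV[R]_k) -> R -> 'cV[R]_n) :=
  forall u, solvable u -> is_solution u (x_ u).

Section costs.
Variables (x_ : (R -> 'cV[R]_k) -> R -> 'cV[R]_n) (P : 'M[R]_n).

Definition J0 u : \bar R :=
  (if `[< solvable u >]
   then \int[@leb R]_(t in horizon T) (quad P (x_ u t))%:E
   else +oo)%E.

Definition Jeps (rho : R -> 'cV[R]_k -> R) (eps : R) u : \bar R :=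
  (if `[< solvable u >]
   then \int[@leb R]_(t in horizon T)
          (quad P (x_ u t) + eps * rho t (u t))%:E
   else +oo)%E.

End costs.

(* Trajectories live on [0, T[, so x(T) is the left limit at T.  None stands for
   the absence of an endpoint condition. *)
Definition endpoint (xT : option 'cV[R]_n) x : Prop :=
  match xT with
  | None => True
  | Some y => x t @[t --> (fine T)^'-] --> y
  end.

Section infima.
Variables (xT : option 'cV[R]_n) (x_ : (R -> 'cV[R]_k) -> R -> 'cV[R]_n).

Definition inf_cost (U : set (R -> 'cV[R]_k)) (J : (R -> 'cV[R]_k) -> \bar R) :
    \bar R :=
  ereal_inf [set J u | u in [set u | U u /\ endpoint xT (x_ u)]].

Definition lavrentiev_gap (P : 'M[R]_n) (U V : set (R -> 'cV[R]_k)) : Prop :=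
  (inf_cost U (J0 x_ P) < inf_cost V (J0 x_ P))%E.

End infima.

End control_system.

(* Main.v *)
(* Without any assumption on the gap, the left-hand limit exists and equals
   inf_{U_rho} J_0: for u in U_rho one has
     J_0(u) <= J_eps(u) <= J_0(u) + eps * int rho(t, u(t)) dt
   with a finite last integral, and J_eps(u) is nondecreasing in eps, so the
   limit as eps -> 0+ of the infimum over u is the infimum over eps of the
   infimum over u, and the two infima commute.  As inf_U J_0 <= inf_{U_rho} J_0,
   uniqueness of limits turns the stated equality into the absence of a gap. *)
Require Import Defs.
From HB Require Import structures.
From mathcomp Require Import all_boot all_order all_algebra.
From mathcomp Require Import all_classical all_reals all_analysis.
From mathcomp Require Import measurable_realfun.
Import Order.TTheory GRing.Theory Num.Theory.
Import numFieldNormedType.Exports.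
Local Open Scope classical_set_scope.
Local Open Scope ring_scope.

Section lower_integral.
Local Open Scope ereal_scope.
Context {d : measure_display} {T : measurableType d} {R : realType}.
Import HBNNSimple.
Context {mu : {measure set T -> \bar R}} {D : set T}.

(** No measurability enters: the integral is a supremum over simple functions below the integrand,
    and those below [f1] are below [f2]. *)
Lemma ge0_integral_mono (f1 f2 : T -> \bar R) :
  (forall x, D x -> 0 <= f1 x) -> (forall x, D x -> f1 x <= f2 x) ->
  \int[mu]_(x in D) f1 x <= \int[mu]_(x in D) f2 x.
Proof.
move=> f10 f12.
have f20 x : D x -> 0 <= f2 x.
  by move=> Dx; exact: le_trans (f10 x Dx) (f12 x Dx).
rewrite !ge0_integralE//; apply: ereal_sup_le => _ [h /= hf1 <-].
by exists h => //= x; exact: le_trans (hf1 x) (lee_restrict f12 x).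
Qed.

Lemma ge0_integral_le_minorants (f : T -> R) (M : \bar R) : measurable D ->
  (forall x, D x -> 0 <= f x)%R ->
  (forall h : T -> R, measurable_fun D h ->
    (forall x, D x -> 0 <= h x <= f x)%R ->
    \int[mu]_(x in D) (h x)%:E <= M) ->
  \int[mu]_(x in D) (f x)%:E <= M.
Proof.
move=> mD f0 hM; rewrite ge0_integralE//.
apply: ge_ereal_sup => _ [h /= hf <-].
have -> : sintegral mu h = \int[mu]_(x in D) (h x)%:E.
  transitivity (\int[mu]_(x in setT) (h x)%:E).
    by rewrite integral_nnsfun// patch_setT.
  rewrite [RHS]integral_mkcond.
  (* Off [D], [h] is squeezed between 0 and the zero extension of [f], so restricting it to [D]
     keeps its integral. *)
  apply: eq_integral => x _; rewrite patchE; case: ifPn => // /negP xD.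
  apply/eqP; rewrite eq_le lee_fin; apply/andP; split; last exact: fun_ge0.
  by have := hf x; rewrite patchE; case: ifPn => // /xD.
apply: hM => [|x Dx]; first exact: measurable_funTS.
apply/andP; split; first exact: fun_ge0.
by rewrite -lee_fin; have := hf x; rewrite patchE mem_set.
Qed.

(* The integral of a nonnegative function, measurable or not, is the supremum of
   the integrals of its measurable minorants.  A measurable minorant h of q + e r
   gives the measurable minorant max(h - q, 0) / e of r, so no measurability of
   t |-> rho t (u t) has to be established. *)
Lemma ge0_integral_addZ_le (q r : T -> R) (e : R) : measurable D ->
  measurable_fun D q -> (forall x, D x -> 0 <= q x)%R ->
  (forall x, D x -> 0 <= r x)%R -> (0 < e)%R ->
  \int[mu]_(x in D) (q x + e * r x)%:E <=
  \int[mu]_(x in D) (q x)%:E + e%:E * \int[mu]_(x in D) (r x)%:E.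
Proof.
move=> mD mq q0 r0 e0; apply: ge0_integral_le_minorants => // [x Dx|h mh hqr].
  by rewrite addr_ge0 ?q0// mulr_ge0 ?r0 ?(ltW e0).
pose s x := (e^-1 * Num.max (h x - q x) 0)%R.
have s0 x : D x -> (0 <= s x)%R.
  by move=> _; rewrite mulr_ge0 ?invr_ge0 ?(ltW e0)// le_max lexx orbT.
have ms : measurable_fun D s.
  apply: measurable_funM => //; apply: measurable_maxr => //.
  exact: measurable_funB.
have sr x : D x -> (s x <= r x)%R.
  move=> Dx; rewrite /s ler_pdivrMl// ge_max mulr_ge0 ?r0 ?(ltW e0)// andbT.
  by rewrite lerBlDl; case/andP: (hqr x Dx).
have hqs x : D x -> (h x)%:E <= (q x)%:E + e%:E * (s x)%:E.
  move=> Dx; rewrite -EFinM -EFinD lee_fin /s mulrA divff ?gt_eqF// mul1r.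
  by rewrite -lerBlDl le_max lexx.
(* Additivity is used only for the measurable pair [q], [s]; monotonicity then replaces [s] by
   [r]. *)
apply: (@le_trans _ _ (\int[mu]_(x in D) ((q x)%:E + e%:E * (s x)%:E))).
  by apply: ge0_integral_mono => // x Dx; case/andP: (hqr x Dx).
have mse : measurable_fun D (fun x => (s x)%:E) by exact/measurable_EFinP.
rewrite ge0_integralD//; last 3 first.
- exact/measurable_EFinP.
- by move=> x Dx; rewrite -EFinM lee_fin mulr_ge0 ?s0 ?(ltW e0).
- exact: measurable_funeM.
rewrite ge0_integralZl_EFin ?(ltW e0)//.
rewrite leeD2l// lee_wpmul2l ?lee_fin ?(ltW e0)//.
by apply: ge0_integral_mono => x Dx; rewrite lee_fin ?s0 ?sr.
Qed.

End lower_integral.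

Section trajectory_cost_measurable.
Context {R : realType}.

Lemma lebR_measurable (A : set R) : measurable A -> measurable (A : set (lebR R)).
Proof. exact: sub_caratheodory. Qed.

(** Preimages under a continuous function are Borel in [D], hence Lebesgue measurable, as
    integration against [leb] demands. *)
Lemma within_continuous_lebR_measurable (D : set R) (f : R -> R) :
  measurable D -> {within D, continuous f} ->
  measurable_fun (D : set (lebR R)) (f : lebR R -> R).
Proof.
move=> mD cf _ Y mY; apply: lebR_measurable.
exact: (@subspace_continuous_measurable_fun R D f mD cf mD Y mY).
Qed.

Lemma horizon_openE (T : \bar R) :
  horizon_open T = `[0, +oo[%classic `&` EFin @^-1` `]-oo, T[%classic.
Proof.
apply/seteqP; split=> t /=; rewrite /horizon_open/= !in_itv/= andbT.
  by case.
by [].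
Qed.

Lemma measurable_horizon_open (T : \bar R) : measurable (horizon_open T).
Proof.
rewrite horizon_openE; apply: measurableI => //.
by rewrite -[X in measurable X]setTI; apply: EFin_measurable => //; exact: emeasurable_itv.
Qed.

(** Isolates the end point of a finite horizon, where a solution may take any value. *)
Lemma horizonE (T : \bar R) : (0 < T)%E ->
  horizon T =
    horizon_open T `|` (if T \is a fin_num then [set fine T] else set0).
Proof.
case: T => [r| |]// r0; apply/seteqP; split => t /=; rewrite /horizon /horizon_open/=.
- by case=> t0; rewrite lee_fin le_eqVlt lte_fin => /predU1P[->|]; [right|left].
- move=> [[t0 /ltW//]|->]; rewrite lexx; split => //; exact/ltW.
- by move=> [t0 _]; left; rewrite ltry.
- by move=> [[t0 _]|//]; rewrite leey.
Qed.

Lemma measurable_horizon (T : \bar R) : (0 < T)%E -> measurable (horizon T).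
Proof.
move=> T0; rewrite horizonE//; apply: measurableU.
  exact: measurable_horizon_open.
by case: ifP.
Qed.

Lemma quadE n (P : 'M[R]_n) (x : 'cV[R]_n) :
  quad P x = \sum_j (\sum_i x i ord0 * P i j) * x j ord0.
Proof.
rewrite /quad mxE; apply: eq_bigr=> j _; rewrite mxE; congr (_ * _).
by apply: eq_bigr=> i _; rewrite mxE.
Qed.

Lemma quad_ge0 n (P : 'M[R]_n) (x : 'cV[R]_n) : sym_posdef P -> 0 <= quad P x.
Proof.
move=> [_ P0]; have [->|/P0/ltW//] := eqVneq x 0.
by rewrite /quad mulmx0 mxE.
Qed.

Lemma quad_measurable n (P : 'M[R]_n) (T : \bar R) (x : R -> 'cV[R]_n) :
  (0 < T)%E -> {within horizon_open T, continuous x} ->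
  measurable_fun (horizon T : set (lebR R)) (fun t : lebR R => quad P (x t)).
Proof.
move=> T0 cx; under eq_fun do rewrite quadE.
have mh := measurable_horizon_open T.
have mx i : measurable_fun (horizon T : set (lebR R))
    (fun t : lebR R => x t i ord0).
  rewrite horizonE//; apply/measurable_funU.
  - exact: lebR_measurable.
  - by apply: lebR_measurable; case: ifP.
  split; last first.
    by case: ifP; [move=> _; exact: measurable_fun_set1|
      move=> _; exact: measurable_fun_set0].
  apply: within_continuous_lebR_measurable => // t.
  exact: (continuous_comp (cx t) (@coord_continuous _ _ _ i ord0 (x t))).
apply: measurable_sum => j; apply: measurable_funM => //.
by apply: measurable_sum => i; exact: measurable_funM.
Qed.

End trajectory_cost_measurable.

(** Here [i] plays the control and [c i] its penalty integral. The penalties are finite but perhaps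
    unbounded over [A], so [e] is chosen separately for each [i]. *)
Lemma ereal_inf_perturbation_cvg {R : realType} {I : Type} (A : set I)
    (J0 c : I -> \bar R) (J : R -> I -> \bar R) :
  (forall i, A i -> (0 <= c i < +oo)%E) ->
  (forall e i, 0 < e -> A i -> (J0 i <= J e i <= J0 i + e%:E * c i)%E) ->
  (forall e e' i, 0 < e -> e <= e' -> A i -> (J e i <= J e' i)%E) ->
  ereal_inf [set J e i | i in A] @[e --> 0^'+] --> ereal_inf [set J0 i | i in A].
Proof.
move=> c_fin J_bound J_nd.
suff -> : ereal_inf [set J0 i | i in A] =
    ereal_inf [set ereal_inf [set J e i | i in A] | e in [set` `]0%R, +oo[]].
  apply: nondecreasing_at_right_cvge => // e e'.
  rewrite !in_itv/= !andbT => e0 _ ee'.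
  apply: le_ereal_inf_tmp => _ [i Ai <-]; apply: ge_ereal_inf.
  by exists (J e i); [exists i|exact: J_nd].
apply/eqP; rewrite eq_le; apply/andP; split; apply: le_ereal_inf_tmp.
  move=> _ [e /= + <-]; rewrite in_itv/= andbT => e0.
  apply: le_ereal_inf_tmp => _ [i Ai <-]; apply: ge_ereal_inf.
  by exists (J0 i); [exists i|case/andP: (J_bound e i e0 Ai)].
move=> _ [i Ai <-]; apply/lee_addgt0Pr => d d0.
have c_num : c i \is a fin_num by rewrite ge0_fin_numE; case/andP: (c_fin i Ai).
have c0 : 0 <= fine (c i) by rewrite fine_ge0//; case/andP: (c_fin i Ai).
(* This makes [e * c i] at most [d]; the added 1 keeps the denominator positive when [c i] is 0. *)
pose e := d / (fine (c i) + 1).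
have e0 : 0 < e by rewrite divr_gt0// ltr_wpDl.
apply: (@le_trans _ _ (J e i)).
  apply: ge_ereal_inf; exists (ereal_inf [set J e i | i in A]).
    by exists e => //=; rewrite in_itv/= e0.
  by apply: ereal_inf_lbound; exists i.
have /andP[_ /le_trans] := J_bound e i e0 Ai; apply.
rewrite leeD2l// -(fineK c_num) -EFinM lee_fin /e mulrAC ler_pdivrMr ?ltr_wpDl//.
by rewrite ler_pM2l// lerDl.
Qed.

Section cost_bounds.
Context {R : realType} {n k : nat} {T : \bar R} {P : 'M[R]_n}.
Context {f : 'cV[R]_n -> 'cV[R]_n} {g : 'I_k -> 'cV[R]_n -> 'cV[R]_n}.
Context {x0 : 'cV[R]_n} {rho : R -> 'cV[R]_k -> R}.
Context {x_ : (R -> 'cV[R]_k) -> R -> 'cV[R]_n}.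
Hypothesis hT : (0 < T)%E.
Hypothesis hP : sym_posdef P.
Hypothesis hrho0 : forall t v, horizon T t -> 0 <= rho t v.
Hypothesis hx : trajectory_map T f g x0 x_.

Local Notation J0 := (J0 T f g x0 x_ P).
Local Notation Jeps := (Jeps T f g x0 x_ P rho).

Lemma J0_le_Jeps e u : 0 < e -> (J0 u <= Jeps e u)%E.
Proof.
rewrite /Defs.J0 /Defs.Jeps => e0; case: ifP => // _.
apply: ge0_integral_mono => t Tt; rewrite lee_fin ?quad_ge0//.
by rewrite lerDl mulr_ge0 ?hrho0 ?ltW.
Qed.

Lemma Jeps_nondecreasing e e' u : 0 < e -> e <= e' -> (Jeps e u <= Jeps e' u)%E.
Proof.
rewrite /Defs.Jeps => e0 ee'; case: ifP => // _.
apply: ge0_integral_mono => t Tt; rewrite lee_fin.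
  by rewrite addr_ge0 ?quad_ge0// mulr_ge0 ?hrho0 ?ltW.
by rewrite lerD2l ler_wpM2r ?hrho0.
Qed.

Lemma Jeps_le e u : 0 < e ->
  (Jeps e u <= J0 u +
    e%:E * \int[@leb R]_(t in horizon T) (rho t (u t))%:E)%E.
Proof.
have rho0 : (0 <= \int[@leb R]_(t in horizon T) (rho t (u t))%:E)%E.
  by apply: integral_ge0 => t Tt; rewrite lee_fin hrho0.
rewrite /Defs.J0 /Defs.Jeps => e0; case: asboolP => [/hx[xu_cont _]|_]; last first.
  (* Without a solution both costs are [+oo]; the nonnegative penalty is not [-oo], so the
     right-hand side stays [+oo]. *)
  by rewrite addye// gt_eqF// (lt_le_trans (ltNyr 0))// mule_ge0// lee_fin ltW.
apply: ge0_integral_addZ_le => // [| |t _|t Tt].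
- by apply: lebR_measurable; exact: measurable_horizon.
- exact: quad_measurable.
- exact: quad_ge0.
- exact: hrho0.
Qed.

(** The endpoint condition merely shrinks the common index set of the infima, and membership in
    [Urho] supplies the finite penalty. *)
Lemma inf_Jeps_cvg (xT : option 'cV[R]_n) :
  inf_cost T xT x_ (Urho T rho) (Jeps eps) @[eps --> 0^'+] -->
  inf_cost T xT x_ (Urho T rho) J0.
Proof.
apply: (@ereal_inf_perturbation_cvg _ _ _ _
  (fun u => \int[@leb R]_(t in horizon T) (rho t (u t))%:E)%E).
- move=> u [[_ rho_fin] _]; rewrite rho_fin andbT.
  by apply: integral_ge0 => t Tt; rewrite lee_fin hrho0.
- by move=> e u e0 _; rewrite J0_le_Jeps// Jeps_le.
- by move=> e e' u e0 ee' _; exact: Jeps_nondecreasing.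
Qed.

End cost_bounds.

Theorem theorem2p3 (R : realType) (n k : nat) (T : \bar R) (hT : (0 < T)%E)
  (P : 'M[R]_n) (hP : sym_posdef P)
  (f : 'cV[R]_n -> 'cV[R]_n) (hf : smooth f)
  (g : 'I_k -> 'cV[R]_n -> 'cV[R]_n) (hg : forall j, smooth (g j))
  (x0 : 'cV[R]_n)
  (xT : option 'cV[R]_n) (hxT : T = +oo%E -> xT = None)
  (rho : R -> 'cV[R]_k -> R) (hrho : borel_on (horizon T) rho)
  (hrho0 : forall t v, horizon T t -> 0 <= rho t v)
  (U : set (R -> 'cV[R]_k)) (hU : Urho T rho `<=` U)
  (x_ : (R -> 'cV[R]_k) -> R -> 'cV[R]_n)
  (hx : trajectory_map T f g x0 x_) :
  (inf_cost T xT x_ (Urho T rho) (Jeps T f g x0 x_ P rho eps)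
     @[eps --> 0^'+] --> inf_cost T xT x_ U (J0 T f g x0 x_ P)) <->
  ~ lavrentiev_gap T f g x0 xT x_ P U (Urho T rho).
Proof.
have inf_U_le : (inf_cost T xT x_ U (J0 T f g x0 x_ P) <=
    inf_cost T xT x_ (Urho T rho) (J0 T f g x0 x_ P))%E.
  by apply: ereal_inf_le_tmp => _ [u [/hU Uu xTu] <-]; exists u.
have cvg_Urho := inf_Jeps_cvg hT hP hrho0 hx xT.
split=> [cvg_U|/negP]; rewrite /lavrentiev_gap.
  (* Both infima are limits of the same function, so a gap would put a value strictly below
     itself. *)
  by rewrite (cvg_unique (@ereal_hausdorff R) cvg_U cvg_Urho) ltxx.
rewrite -leNgt => inf_Urho_le.
suff -> : inf_cost T xT x_ U (J0 T f g x0 x_ P) =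
    inf_cost T xT x_ (Urho T rho) (J0 T f g x0 x_ P) by [].
by apply/eqP; rewrite eq_le inf_U_le.
Qed.
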